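(* Let $\mu_1,\nu_1,\mu_2,\nu_2$ be distributions on $\mathbb{C}[x]$. Then, as formal power series, $$\eta_{\mu_1\rhd_{\nu_2}\mu_2}(z)=\frac{\eta_{\mu_2}(z)}{\eta_{\nu_2}(z)}\,\eta_{\mu_1}(\eta_{\nu_2}(z)),\qquad \eta_{\nu_1\rhd\nu_2}(z)=\eta_{\nu_1}(\eta_{\nu_2}(z)).$$ Here $\frac{\eta_{\mu_1}(\eta_{\nu_2}(z))}{\eta_{\nu_2}(z)}$ means $h(\eta_{\nu_2}(z))$ with $h(w)=\eta_{\mu_1}(w)/w$. In particular, if $\eta_{\nu_2}=0$ (for instance if $\nu_2$ corresponds to the normalized Haar measure on the unit circle), the first relation reads $\eta_{\mu_1\rhd_{\nu_2}\mu_2}(z)=\mu_1(x)\,\eta_{\mu_2}(z)$. If all distributions arise from probability measures on the unit circle $\mathbb{T}$, both relations hold as identities of analytic functions on $|z|<1$.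
   Context: A distribution is a unital linear functional $\mu$ on $\mathbb{C}[x]$. Its Cauchy transform is the formal series $G_\mu(z)=\sum_{n\ge0}\mu(x^n)z^{-n-1}$. Define $\eta_\mu(z)=1-\frac{z}{G_\mu(1/z)}$; equivalently $\eta_\mu=\psi_\mu/(1+\psi_\mu)$ with $\psi_\mu(z)=\sum_{n\ge1}\mu(x^n)z^n$. A probability measure $\mu$ on $\mathbb{T}$ is identified with the distribution $\mu(x^n)=\int_{\mathbb{T}}\zeta^n\,d\mu(\zeta)$; then $\eta_\mu$ is analytic on the unit disc. An algebraic probability space $(\mathcal{A},\varphi,\psi)$ is a unital complex algebra with two unital linear functionals. For $X\in\mathcal{A}$, $\mu_X(x^n)=\varphi(X^n)$ and $\nu_X(x^n)=\psi(X^n)$. Subalgebras $\{\mathcal{A}_i\}_{i\in I}$ (not containing the unit, with $I$ linearly ordered) are c-monotone independent if for all $X_k\in\mathcal{A}_{i_k}$: - (1) $\varphi(X_1\cdots X_n)=\varphi(X_1)\varphi(X_2\cdots X_n)$ if $i_1>i_2$; - (2) $\varphi(X_1\cdots X_n)=\varphi(X_1\cdots X_{n-1})\varphi(X_n)$ if $i_n>i_{n-1}$; - (3) $\varphi(X_1\cdots X_n)=(\varphi(X_j)-\psi(X_j))\varphi(X_1\cdots X_{j-1})\varphi(X_{j+1}\cdots X_n)+\psi(X_j)\varphi(X_1\cdots X_{j-1}X_{j+1}\cdots X_n)$ if $2\le j\le n-1$ and $i_{j-1}<i_j>i_{j+1}$; - (4) (1)–(3) also hold with $\varphi$ replaced by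 $\psi$. Multiplicative c-monotone convolution: if $X-1$ and $Y$ are c-monotone independent (the algebra of $X-1$ first), then $(\mu_{XY},\nu_{XY})=:(\mu_X\rhd_{\nu_Y}\mu_Y,\ \nu_X\rhd\nu_Y)$. The left component depends only on $\mu_X,\mu_Y,\nu_Y$. The right component is the multiplicative monotone convolution. This defines the operations for arbitrary distributions. *)

(* Defs.v *)
From HB Require Import structures.
From mathcomp Require Import all_boot all_order all_algebra.
From mathcomp Require Import all_classical all_reals all_analysis.
From mathcomp Require Import complex.

Set Implicit Arguments.
Unset Strict Implicit.
Unset Printing Implicit Defensive.

Import Order.TTheory GRing.Theory Num.Theory.
Import numFieldTopology.Exports numFieldNormedType.Exports.
Local Open Scope ring_scope.

Section FPS.
Variable K : comNzRingType.

Definition fps := nat -> K.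

Definition fmul (a b : fps) : fps :=
  fun n => \sum_(i < n.+1) a i * b (n - i)%N.

Definition fone : fps := fun n => if n == 0%N then 1 else 0.

Definition fpow (a : fps) (k : nat) : fps := iter k (fmul a) fone.

(* composition f(g(z)), meaningful when g 0 = 0 (then g^k has valuation >= k) *)
Definition fcomp (f g : fps) : fps :=
  fun n => \sum_(k < n.+1) f k * fpow g k n.

(* h(w) = f(w)/w, meaningful when f 0 = 0 *)
Definition fshift (f : fps) : fps := fun n => f n.+1.

Definition psi_ser (m : nat -> K) : fps :=
  fun n => if n == 0%N then 0 else m n.

(* eta_mu = psi_mu / (1 + psi_mu) = sum_{k>=1} (-1)^(k+1) psi_mu^k,
   i.e. the composition of w/(1+w) with psi_mu (psi_mu has zero constant term) *)
Definition w_over_1pw : fps :=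
  fun k => if k == 0%N then 0 else (-1) ^+ k.+1.

Definition eta_ser (m : nat -> K) : fps := fcomp w_over_1pw (psi_ser m).

End FPS.

Section CMonotone.
Variable C : comNzRingType.
Variable A : algType C.

(* the non-unital subalgebra generated by a: polynomials in a without constant term *)
Definition in_nualg (a X : A) : Prop :=
  exists (n : nat) (c : nat -> C), X = \sum_(1 <= k < n) c k *: a ^+ k.

(* A word X_1 ... X_n is a list of pairs (index, element); index false is the
   first algebra (generated by a), index true the second (generated by b);
   the order is false < true. *)
Definition word_ok (a b : A) (s : seq (bool * A)) : Prop :=
  forall p, p \in s -> in_nualg (if p.1 then b else a) p.2.

Definition wprod (s : seq (bool * A)) : A := \prod_(p <- s) p.2.

Definition cmono_conds (a b : A) (th ps : A -> C) : Prop :=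
  (forall X1 X2 t,
      word_ok a b ((true, X1) :: (false, X2) :: t) ->
      th (wprod ((true, X1) :: (false, X2) :: t))
      = th X1 * th (wprod ((false, X2) :: t))) /\
  (forall t Xm Xn,
      word_ok a b (rcons (rcons t (false, Xm)) (true, Xn)) ->
      th (wprod (rcons (rcons t (false, Xm)) (true, Xn)))
      = th (wprod (rcons t (false, Xm))) * th Xn) /\
  (forall l r Xa Xj Xc,
      word_ok a b (l ++ [:: (false, Xa); (true, Xj); (false, Xc)] ++ r) ->
      th (wprod (l ++ [:: (false, Xa); (true, Xj); (false, Xc)] ++ r))
      = (th Xj - ps Xj) * th (wprod (rcons l (false, Xa)))
                        * th (wprod ((false, Xc) :: r))
        + ps Xj * th (wprod (l ++ [:: (false, Xa); (false, Xc)] ++ r))).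

Definition c_monotone_indep (phi psi : A -> C) (a b : A) : Prop :=
  cmono_conds a b phi psi /\ cmono_conds a b psi psi.

Definition distr (th : A -> C) (X : A) : nat -> C := fun n => th (X ^+ n).

End CMonotone.

Section Circle.
Variable R : realType.
Local Notation C := R[i].
Local Open Scope complex_scope.

(* m is the moment sequence of a probability measure on T: every probability
   measure on T is the push-forward of a probability measure P on R under
   t |-> e^{it}, and m n = int zeta^n dmu = int e^{int} dP(t). *)
Definition circle_moments (m : nat -> C) : Prop :=
  exists P : probability R R,
    forall n : nat,
      m n = (Rintegral P setT (fun t => cos (n%:R * t)))
             +i* (Rintegral P setT (fun t => sin (n%:R * t))).

Definition ser_value (a : nat -> C) (z : C) : C :=
  (limn (fun N => (complex.Re (\sum_(k < N) a k * z ^+ k) : R)))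
  +i* (limn (fun N => (complex.Im (\sum_(k < N) a k * z ^+ k) : R))).

Definition psi_fun (m : nat -> C) (z : C) : C := ser_value (psi_ser m) z.
Definition eta_fun (m : nat -> C) (z : C) : C :=
  psi_fun m z / (1 + psi_fun m z).
Definition h_fun (m : nat -> C) (w : C) : C :=
  if w == 0 then m 1%N else eta_fun m w / w.

End Circle.

(* Main.v *)
Require Import Defs.
From HB Require Import structures.
From mathcomp Require Import all_boot all_order all_algebra.
From mathcomp Require Import all_classical all_reals all_analysis.
From mathcomp Require Import complex.
From mathcomp Require Import ring lra zify.
Set Implicit Arguments.
Unset Strict Implicit.
Unset Printing Implicit Defensive.
Import Order.TTheory GRing.Theory Num.Theory.
Import numFieldTopology.Exports numFieldNormedType.Exports.
Local Open Scope ring_scope.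

(** Formal part. Put a = X - 1, V = sum_n Y (X Y)^(n-1) z^n and B = sum_(n>=1) Y^n z^n,
    so that V = B + B a V and 1 + psi_(XY) is the functional applied to 1 + V + a V.
    With b, b' the values of the two functionals on B, c-monotone independence gives
      E_k = th(a^k) (b + (b - b') E_1) + b' E_(k+1)   for E_k = th(a^k V), k >= 1,
    whence E_1 = al (b + (b - b') E_1) with al = sum_k th(a^(k+1)) b'^k. The same series
    al governs psi_X at w = eta_Y = b' / (1 + b'), because M_k = sum_n th(a^k X^n) w^n
    satisfies M_k = th(a^k) (1 + b') + b' M_(k+1). Eliminating al gives the formula; all
    cancelled factors have constant term 1, so b' = 0 needs no special treatment.

    Analytic part. For a probability measure on the circle, 1 + 2 psi has nonnegative real
    part as a truncated Toeplitz form, so multiplication by eta, and by eta / z, is an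
    l^2 contraction on truncations. Hence all coefficients of all powers of eta and of
    eta / z are at most 1 in modulus. This bounds the coefficients of all powers of the
    eta-series of the convolution polynomially, so that its psi-series converges on the
    unit disc, and it justifies evaluating products and compositions there. *)

(** * The ring of formal power series *)

(* An alias of [fps], since [nat -> K] already carries the pointwise ring structure. *)
Definition psr (K : comNzRingType) : Type := fps K.

Section PowerSeriesRing.
Variable K : comNzRingType.
Implicit Types a b c : psr K.

HB.instance Definition _ := gen_eqMixin (psr K).
HB.instance Definition _ := gen_choiceMixin (psr K).

Definition psr_add a b : psr K := fun n => a n + b n.
Definition psr_opp a : psr K := fun n => - a n.
Definition psr_zero : psr K := fun _ => 0.

Fact psr_addA : associative psr_add.
Proof. by move=> a b c; apply/funext => n; rewrite /psr_add addrA. Qed.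
Fact psr_addC : commutative psr_add.
Proof. by move=> a b; apply/funext => n; rewrite /psr_add addrC. Qed.
Fact psr_add0 : left_id psr_zero psr_add.
Proof. by move=> a; apply/funext => n; rewrite /psr_add add0r. Qed.
Fact psr_addN : left_inverse psr_zero psr_opp psr_add.
Proof. by move=> a; apply/funext => n; rewrite /psr_add /psr_opp addNr. Qed.

HB.instance Definition _ :=
  GRing.isZmodule.Build (psr K) psr_addA psr_addC psr_add0 psr_addN.

(** Coefficient [n] of a product only sees coefficients up to [n], so the ring laws can be read off
    from polynomial truncations. *)
Lemma fmul_coefM a b (p q : {poly K}) n :
  (forall i, (i <= n)%N -> a i = p`_i) -> (forall i, (i <= n)%N -> b i = q`_i) ->
  fmul a b n = (p * q)`_n.
Proof.
move=> ap bq; rewrite coefM; apply: eq_bigr => i _.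
by rewrite ap ?bq ?leq_subr // -ltnS.
Qed.

Let tr n a : {poly K} := \poly_(i < n.+1) a i.
Let trE n a i : (i <= n)%N -> a i = (tr n a)`_i.
Proof. by move=> le_in; rewrite coef_poly ltnS le_in. Qed.

Fact psr_mulC : commutative (@fmul K : psr K -> psr K -> psr K).
Proof.
move=> a b; apply/funext => n.
rewrite (@fmul_coefM _ _ (tr n a) (tr n b) n); try exact: trE.
by rewrite mulrC -(@fmul_coefM b a) // => i; apply: trE.
Qed.

Fact psr_mulA : associative (@fmul K : psr K -> psr K -> psr K).
Proof.
move=> a b c; apply/funext => n.
rewrite (@fmul_coefM _ _ (tr n a) (tr n b * tr n c) n); first 1 last.
- by move=> i; exact: trE.
- move=> i le_in; apply: fmul_coefM => j le_ji; exact/trE/(leq_trans le_ji).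
rewrite (@fmul_coefM _ _ (tr n a * tr n b) (tr n c) n) ?mulrA //.
- move=> i le_in; apply: fmul_coefM => j le_ji; exact/trE/(leq_trans le_ji).
- by move=> i; exact: trE.
Qed.

Fact psr_mul1 : left_id (@fone K) (@fmul K : psr K -> psr K -> psr K).
Proof.
move=> a; apply/funext => n; rewrite /fmul big_ord_recl /= mul1r subn0.
by rewrite big1 ?addr0 // => i _; rewrite mul0r.
Qed.

Fact psr_mulDl : left_distributive (@fmul K : psr K -> psr K -> psr K) +%R.
Proof.
move=> a b c; apply/funext => n; rewrite /= /fmul -[RHS]big_split /=.
by apply: eq_bigr => i _; rewrite -mulrDl.
Qed.

Fact psr_one_neq0 : (@fone K : psr K) != 0.
Proof. by apply/eqP => /(congr1 (@^~ 0%N)) /= /eqP; rewrite oner_eq0. Qed.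

HB.instance Definition _ := GRing.Zmodule_isComNzRing.Build (psr K)
  psr_mulA psr_mulC psr_mul1 psr_mulDl psr_one_neq0.

Lemma psrD a b n : (a + b) n = a n + b n. Proof. by []. Qed.
Lemma psrN a n : (- a) n = - a n. Proof. by []. Qed.
Lemma psr0 n : (0 : psr K) n = 0. Proof. by []. Qed.
Lemma psr1 n : (1 : psr K) n = (n == 0%N)%:R. Proof. by case: n. Qed.
Lemma psrM a b n : (a * b) n = \sum_(i < n.+1) a i * b (n - i)%N.
Proof. by []. Qed.
Lemma psrM0 a b : (a * b) 0%N = a 0%N * b 0%N.
Proof. by rewrite psrM big_ord_recl big_ord0 addr0. Qed.
Lemma psrX a k : a ^+ k = fpow a k.
Proof. by elim: k => // k IHk; rewrite exprS IHk. Qed.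

Definition psrC (c : K) : psr K := fun n => if n == 0%N then c else 0.

Lemma psrCM (c : K) a n : (psrC c * a) n = c * a n.
Proof.
rewrite psrM big_ord_recl /= subn0 big1 ?addr0 // => i _.
by rewrite /psrC /= mul0r.
Qed.

Lemma psrC1 : psrC 1 = 1. Proof. by []. Qed.

Lemma psrM_low a b m n :
  (forall i, (i < m)%N -> a i = 0) -> (forall i, (i + m <= n)%N -> b i = 0) ->
  (a * b) n = 0.
Proof.
move=> a0 b0; rewrite psrM big1 // => i _; case: (ltnP i m) => [/a0 ->|le_mi].
  by rewrite mul0r.
by rewrite b0 ?mulr0 //; have := ltn_ord i; lia.
Qed.

(* A family reproducing itself up to a factor without constant term is
   divisible by all powers of z. *)
Lemma psr_contract_eq0 (I : Type) (D : I -> psr K) (next : I -> I) (p : psr K) :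
  p 0%N = 0 -> (forall i, D i = p * D (next i)) -> forall i, D i = 0.
Proof.
move=> p0 DE i; apply/funext => n; rewrite psr0.
have [m] := ubnP n; elim: m n i => // m IHm n i lt_nm.
rewrite DE; apply: (@psrM_low _ _ 1) => [[|j]//|j le_jn]; apply: IHm; lia.
Qed.

(** The difference [d] of [b] and [c] satisfies [d = (1 - a) * d], where [1 - a] has no constant
    term. This cancellation stands in for division. *)
Lemma psr_mulIf a b c : a 0%N = 1 -> a * b = a * c -> b = c.
Proof.
move=> a0 eq_ab; apply/eqP; rewrite -subr_eq0; apply/eqP.
apply: (@psr_contract_eq0 unit (fun=> b - c) id (1 - a) _ _ tt) => [|_].
  by rewrite psrD psrN psr1 a0 subrr.
have: a * (b - c) = 0 by rewrite mulrBr eq_ab subrr.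
by move=> ac; rewrite mulrBl mul1r ac subr0.
Qed.

Lemma psrX_low a k n : a 0%N = 0 -> (n < k)%N -> (a ^+ k) n = 0.
Proof.
move=> a0; elim: k n => // k IHk n lt_nk.
rewrite exprS; apply: (@psrM_low _ _ 1) => [[|i]//|i le_in]; apply: IHk; lia.
Qed.

(** * Composition of power series *)

Definition comp_psr (f p : psr K) : psr K := fcomp f p.

(** [p ^+ k] vanishes below degree [k], so every bound above [n] gives the same sum; a common bound
    allows sums to be exchanged. *)
Lemma comp_psr_trunc (f p : psr K) n N : p 0%N = 0 -> (n < N)%N ->
  comp_psr f p n = \sum_(k < N) f k * (p ^+ k) n.
Proof.
move=> p0 lt_nN; rewrite /comp_psr /fcomp.
rewrite (big_ord_widen N (fun k => f k * fpow p k n)) //.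
rewrite [RHS](bigID (fun k : 'I_N => (k < n.+1)%N)) /= [X in _ + X]big1 => [|k].
  by rewrite addr0; apply: eq_bigr => k _; rewrite psrX.
by rewrite -ltnNge => ltk; rewrite psrX_low // ?mulr0.
Qed.

Lemma comp_psrD (f g p : psr K) : comp_psr (f + g) p = comp_psr f p + comp_psr g p.
Proof.
apply/funext => n; rewrite psrD /comp_psr /fcomp -big_split /=.
by apply: eq_bigr => i _; rewrite mulrDl.
Qed.

Lemma comp_psrN (f p : psr K) : comp_psr (- f) p = - comp_psr f p.
Proof.
apply/funext => n; rewrite psrN /comp_psr /fcomp -sumrN.
by apply: eq_bigr => i _; rewrite mulNr.
Qed.

Lemma comp_psrCM (c : K) (f p : psr K) : comp_psr (psrC c * f) p = psrC c * comp_psr f p.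
Proof.
apply/funext => n; rewrite psrCM /comp_psr /fcomp big_distrr /=.
by apply: eq_bigr => i _; rewrite psrCM mulrA.
Qed.

(** Horner's rule, the recursion behind most later facts on composition. *)
Lemma comp_psr_shift (f p : psr K) : p 0%N = 0 ->
  comp_psr f p = psrC (f 0%N) + p * comp_psr (fshift f) p.
Proof.
move=> p0; apply/funext => n; rewrite (@comp_psr_trunc _ _ n n.+2) //.
rewrite big_ord_recl expr0 psrD psr1; congr (_ + _).
  by rewrite /psrC; case: ifP; rewrite ?mulr1 ?mulr0.
under eq_bigr => k _ do rewrite exprS psrM mulr_sumr.
rewrite exchange_big psrM; apply: eq_bigr => i _.
rewrite (@comp_psr_trunc _ _ _ n.+1) ?ltnS ?leq_subr // mulr_sumr.
by apply: eq_bigr => k _; rewrite mulrCA.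
Qed.

Definition psr_z : psr K := fun n => (n == 1%N)%:R.

Lemma psr_zM0 a : (psr_z * a) 0%N = 0. Proof. by rewrite psrM0 mul0r. Qed.
Lemma psr_zMS a n : (psr_z * a) n.+1 = a n.
Proof.
rewrite psrM 2!big_ord_recl /= mul0r add0r mul1r subn1 /= big1 ?addr0 //.
by move=> i _; rewrite mul0r.
Qed.

Lemma psr_shiftE a : a = psrC (a 0%N) + psr_z * fshift a.
Proof.
by apply/funext => -[|n]; rewrite psrD /psrC /= ?psr_zM0 ?psr_zMS ?addr0 ?add0r.
Qed.

Lemma fshift_zM a : fshift (psr_z * a) = a.
Proof. by apply/funext => n; rewrite /fshift psr_zMS. Qed.

(** By Horner's rule the defect of multiplicativity satisfies [D f = p * D (fshift f)], hence
    vanishes. *)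
Lemma comp_psrM (f g p : psr K) : p 0%N = 0 ->
  comp_psr (f * g) p = comp_psr f p * comp_psr g p.
Proof.
move=> p0; apply/eqP; rewrite -subr_eq0; apply/eqP.
pose D (f : psr K) := comp_psr (f * g) p - comp_psr f p * comp_psr g p.
apply: (@psr_contract_eq0 _ D (@fshift K) p _ _ f) => // {}f; rewrite /D.
rewrite [in comp_psr (f * g) p](psr_shiftE f) mulrDl comp_psrD comp_psrCM -mulrA.
rewrite [comp_psr (psr_z * _) p]comp_psr_shift // psr_zM0 fshift_zM.
rewrite (_ : psrC 0 = 0); last by apply/funext => -[].
rewrite [comp_psr f p]comp_psr_shift //; ring.
Qed.

Lemma comp_psr1 (p : psr K) : p 0%N = 0 -> comp_psr 1 p = 1.
Proof.
move=> p0; rewrite comp_psr_shift // (_ : comp_psr _ p = 0) ?mulr0 ?addr0 //.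
by apply/funext => n; rewrite /comp_psr /fcomp big1 // => i _; rewrite mul0r.
Qed.

Lemma comp_psrX (f p : psr K) k : p 0%N = 0 -> comp_psr (f ^+ k) p = comp_psr f p ^+ k.
Proof.
by move=> p0; elim: k => [|k IHk]; rewrite ?comp_psr1 // !exprS comp_psrM // IHk.
Qed.

(* Unrolling the recursion gives [M 0 = g * (t 0 + t 1 p + t 2 p ^ 2 + ...)]. *)
Lemma comp_psr_rec (t : nat -> K) (M : nat -> psr K) (g p : psr K) : p 0%N = 0 ->
  (forall k, M k = psrC (t k) * g + p * M k.+1) ->
  M 0%N = comp_psr t p * g.
Proof.
move=> p0 shifted_psi_rec; apply/eqP; rewrite -subr_eq0; apply/eqP.
pose D k := M k - comp_psr (fun n => t (k + n)%N) p * g.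
apply: (@psr_contract_eq0 _ D succn p _ _ 0%N) => // k; rewrite /D.
rewrite [comp_psr (fun n => t (k + n)%N) p]comp_psr_shift //= addn0 shifted_psi_rec.
rewrite (_ : fshift _ = fun n => t (k.+1 + n)%N); first ring.
by apply/funext => n; rewrite /fshift addnS.
Qed.

(** * The series psi and eta *)

Definition psi_psr (m : nat -> K) : psr K := psi_ser m.
Definition eta_psr (m : nat -> K) : psr K := eta_ser m.

Lemma psi_psr0 m : psi_psr m 0%N = 0. Proof. by []. Qed.

Lemma eta_psi m : eta_psr m * (1 + psi_psr m) = psi_psr m.
Proof.
set p := psi_psr m; have p0 : p 0%N = 0 by [].
(* [G] is the alternating geometric series, the inverse of [1 + p], and eta will be [p * G]. *)
pose G := comp_psr (fun k => (-1) ^+ k) p.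
have GE : G = 1 - p * G.
  rewrite {1}/G comp_psr_shift // expr0 psrC1; congr (_ + _).
  rewrite -mulrN -comp_psrN; congr (_ * comp_psr _ p).
  by apply/funext => k; rewrite /fshift psrN exprS mulN1r.
rewrite (_ : eta_psr m = p * G); last first.
  rewrite /eta_psr /eta_ser -[fcomp _ _]/(comp_psr _ p) comp_psr_shift //.
  rewrite (_ : psrC _ = 0) ?add0r; last by apply/funext => -[].
  congr (_ * comp_psr _ p); apply/funext => k.
  by rewrite /fshift /w_over_1pw /= exprSr exprSr mulrN1 mulrN1 opprK.
transitivity (p * (G + p * G)); first ring.
by rewrite {1}GE subrK mulr1.
Qed.

Lemma eta_psi_inv m : (1 - eta_psr m) * (1 + psi_psr m) = 1.
Proof. by rewrite mulrBl mul1r eta_psi addrK. Qed.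

Lemma one_psi0 m : (1 + psi_psr m) 0%N = 1.
Proof. by rewrite psrD psi_psr0 addr0. Qed.

Lemma eta_psr0 m : eta_psr m 0%N = 0.
Proof.
by have := congr1 (@^~ 0%N) (eta_psi m); rewrite /= psrM0 one_psi0 mulr1.
Qed.

(** Since [1 + psi] is cancellable, eta can be identified by checking its defining equation. *)
Lemma eta_psr_uniq m (e : psr K) : e * (1 + psi_psr m) = psi_psr m -> eta_psr m = e.
Proof.
move=> eE; apply: (@psr_mulIf (1 + psi_psr m)); first exact: one_psi0.
by rewrite [LHS]mulrC [RHS]mulrC eE eta_psi.
Qed.

Lemma eta_psr1 m : eta_psr m 1%N = m 1%N.
Proof.
have := congr1 (@^~ 1%N) (eta_psi m); rewrite /= psrM 2!big_ord_recl big_ord0 /=.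
by rewrite eta_psr0 mul0r add0r addr0 subnn one_psi0 mulr1.
Qed.

Lemma eta_shift m : eta_psr m = psr_z * fshift (eta_psr m).
Proof.
rewrite {1}[eta_psr m]psr_shiftE eta_psr0 (_ : psrC 0 = 0) ?add0r //.
by apply/funext => -[].
Qed.

(** The equation of eta with one factor z removed; it ties [eta / z] to the moments without
    dividing. *)
Lemma eta_shift_psi m :
  (fshift (eta_psr m) : psr K) * (1 + psi_psr m) = fshift (psi_psr m).
Proof. by rewrite -{2}(eta_psi m) {2}eta_shift -mulrA fshift_zM. Qed.

End PowerSeriesRing.

(** * Moments of a product of c-monotone independent elements *)

Section MonotoneMoments.
Variables (K : comNzRingType) (A : algType K) (th ps : {scalar A}) (X Y : A).
Hypothesis th1 : th 1 = 1.
Local Notation a := (X - 1).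
Hypothesis Hind : cmono_conds a Y th ps.

Lemma in_nualgX (u : A) k : in_nualg u (u ^+ k.+1).
Proof.
exists k.+2, (fun j => (j == k.+1)%:R).
rewrite big_nat_recr //= eqxx scale1r big1_seq ?add0r // => i.
by rewrite mem_index_iota => /andP[_ /andP[_ ltik]]; rewrite (ltn_eqF ltik) scale0r.
Qed.

Lemma word_ok_cons (c d u : A) (i : bool) (s : seq (bool * A)) :
  in_nualg (if i then d else c) u -> word_ok c d s -> word_ok c d ((i, u) :: s).
Proof. by move=> ui ws p; rewrite inE => /predU1P[-> //|]; apply: ws. Qed.

Lemma word_ok_nil (c d : A) : word_ok c d [::]. Proof. by []. Qed.

Lemma word_ok_cat (c d : A) (s t : seq (bool * A)) :
  word_ok c d s -> word_ok c d t -> word_ok c d (s ++ t).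
Proof. by move=> ws wt p; rewrite mem_cat => /orP[/ws|/wt]. Qed.

Lemma wprod_cons (i : bool) (u : A) s : wprod ((i, u) :: s) = u * wprod s.
Proof. by rewrite /wprod big_cons. Qed.

Lemma wprod_cat (s t : seq (bool * A)) : wprod (s ++ t) = wprod s * wprod t.
Proof. by rewrite /wprod big_cat. Qed.

Lemma wprod_nil : wprod (Nil (bool * A)) = 1. Proof. exact: big_nil. Qed.

Lemma th_aY k i : th (a ^+ k.+1 * Y ^+ i.+1) = th (a ^+ k.+1) * th (Y ^+ i.+1).
Proof.
have [_ [c2 _]] := Hind; have /= := c2 [::] (a ^+ k.+1) (Y ^+ i.+1).
rewrite !wprod_cons wprod_nil !mulr1; apply.
by do 2!(apply: word_ok_cons; first exact: in_nualgX).
Qed.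

Lemma th_Ya_word i s : word_ok a Y s ->
  th (Y ^+ i.+1 * (a * wprod s)) = th (Y ^+ i.+1) * th (a * wprod s).
Proof.
have [c1 _] := Hind; move=> ws; have := c1 (Y ^+ i.+1) a s.
rewrite !wprod_cons; apply.
by do 2!(apply: word_ok_cons; first exact: (in_nualgX _ 0) || exact: in_nualgX).
Qed.

(** Condition (3): deleting the power of [Y] merges [a ^+ k.+1] with the next [a], which is the
    index shift in the recursion for [E]. *)
Lemma th_aYa_word k i s : word_ok a Y s ->
  th (a ^+ k.+1 * (Y ^+ i.+1 * (a * wprod s)))
  = (th (Y ^+ i.+1) - ps (Y ^+ i.+1)) * th (a ^+ k.+1) * th (a * wprod s)
    + ps (Y ^+ i.+1) * th (a ^+ k.+2 * wprod s).
Proof.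
have [_ [_ c3]] := Hind; move=> ws; have /= := c3 [::] s (a ^+ k.+1) (Y ^+ i.+1) a.
rewrite !wprod_cons wprod_nil !mulr1 [a ^+ k.+2]exprSr -!mulrA; apply.
by do 3!(apply: word_ok_cons; first exact: (in_nualgX _ 0) || exact: in_nualgX).
Qed.

(* [(X Y) ^ n.+1 = X (tailY n.+1)]; [tailY n] is the coefficient of z^n in V. *)
Definition tailY n : A := if n is m.+1 then Y * (X * Y) ^+ m else 0.

Lemma tailY_step n : tailY n.+2 = Y * tailY n.+1 + Y * (a * tailY n.+1).
Proof.
rewrite /tailY exprS -mulrA -mulrDr; congr (_ * _).
by rewrite mulrBl mul1r addrC subrK.
Qed.

(* [tailY n] is a sum of words; the induction carries an arbitrary word as prefix. *)
Lemma word_tailY_ind (f g : A -> K) :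
  (forall u v, f (u + v) = f u + f v) -> (forall u v, g (u + v) = g u + g v) ->
  (forall s, word_ok a Y s -> f (wprod s) = g (wprod s)) ->
  forall n, f (tailY n) = g (tailY n).
Proof.
move=> fD gD fg n.
suff gen : forall s, word_ok a Y s -> f (wprod s * tailY n) = g (wprod s * tailY n).
  by have := gen _ (word_ok_nil a Y); rewrite wprod_nil mul1r.
have wY : in_nualg Y Y by exact: (in_nualgX Y 0).
have wa : in_nualg a a by exact: (in_nualgX a 0).
case: n => [|n] s ws.
  rewrite mulr0; have := fD 0 0; have := gD 0 0; rewrite addr0 => g0 f0.
  by rewrite -[LHS](addrK (f 0)) -f0 subrr -[RHS](addrK (g 0)) -g0 subrr.
elim: n s ws => [|n IHn] s ws.
  rewrite /tailY expr0 mulr1 -[Y]mulr1 -wprod_nil -(wprod_cons true) -wprod_cat.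
  by apply: fg; apply: word_ok_cat => //; apply: word_ok_cons.
rewrite tailY_step mulrDr fD gD; congr (_ + _).
  have := IHn (s ++ [:: (true, Y)]).
  rewrite wprod_cat wprod_cons wprod_nil mulr1 -!mulrA; apply.
  by apply: word_ok_cat => //; apply: word_ok_cons.
have := IHn (s ++ [:: (true, Y); (false, a)]).
rewrite wprod_cat !wprod_cons wprod_nil mulr1 -!mulrA; apply.
by apply: word_ok_cat => //; apply: word_ok_cons => //; apply: word_ok_cons.
Qed.

Lemma th_Ya_tailY i n :
  th (Y ^+ i.+1 * (a * tailY n)) = th (Y ^+ i.+1) * th (a * tailY n).
Proof.
apply: (@word_tailY_ind (fun W => th (Y ^+ i.+1 * (a * W)))
  (fun W => th (Y ^+ i.+1) * th (a * W))) => [u v|u v|s].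
- by rewrite !mulrDr linearD.
- by rewrite mulrDr linearD mulrDr.
- exact: th_Ya_word.
Qed.

Lemma th_aYa_tailY k i n : th (a ^+ k.+1 * (Y ^+ i.+1 * (a * tailY n)))
  = (th (Y ^+ i.+1) - ps (Y ^+ i.+1)) * th (a ^+ k.+1) * th (a * tailY n)
    + ps (Y ^+ i.+1) * th (a ^+ k.+2 * tailY n).
Proof.
apply: (@word_tailY_ind (fun W => th (a ^+ k.+1 * (Y ^+ i.+1 * (a * W))))
  (fun W => (th (Y ^+ i.+1) - ps (Y ^+ i.+1)) * th (a ^+ k.+1) * th (a * W)
    + ps (Y ^+ i.+1) * th (a ^+ k.+2 * W))) => [u v|u v|s].
- by rewrite !mulrDr linearD.
- by rewrite !mulrDr !linearD !mulrDr addrACA.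
- exact: th_aYa_word.
Qed.

(** The coefficient of z^(n+1) in V = B + B a V; the summand [i = n] is zero because [tailY 0]
    is. *)
Lemma tailY_expand n :
  tailY n.+1 = Y ^+ n.+1 + \sum_(i < n.+1) Y ^+ i.+1 * (a * tailY (n - i)).
Proof.
elim: n => [|n IHn].
  by rewrite big_ord_recl big_ord0 /= !mulr0 !addr0 mulr1.
rewrite tailY_step {1}IHn mulrDr -exprS -addrA; congr (_ + _).
rewrite [in RHS]big_ord_recl [RHS]addrC; congr (_ + _).
rewrite mulr_sumr; apply: eq_bigr => i _.
by rewrite mulrA -exprS.
Qed.

Let b := psi_psr (distr th Y).
Let b' := psi_psr (distr ps Y).
Let b0 : b 0%N = 0. Proof. by []. Qed.
Let b'0 : b' 0%N = 0. Proof. by []. Qed.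
Let t k := th (a ^+ k).
Let E k : psr K := fun n => th (a ^+ k * tailY n).

Lemma tail_moments0 : E 0%N = b + b * E 1%N.
Proof.
apply/funext => -[|n].
  by rewrite /E psrD psrM0 b0 mul0r addr0 /= mulr0 linear0.
rewrite /E expr0 mul1r tailY_expand linearD psrD psrM [in RHS]big_ord_recl b0 mul0r add0r.
congr (_ + _); rewrite linear_sum; apply: eq_bigr => i _.
by rewrite th_Ya_tailY.
Qed.

(** In the expansion of [tailY], condition (2) handles the leading power of [Y] and condition (3)
    the other summands. *)
Lemma tail_moments_rec k :
  E k.+1 = psrC (t k.+1) * (b + (b - b') * E 1%N) + b' * E k.+2.
Proof.
apply/funext => -[|n].
  rewrite /E !psrD psrCM psrD !psrM0 psrD psrN ?b0 ?b'0.
  by rewrite !(mul0r, mulr0, addr0, subr0, linear0).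
rewrite /E tailY_expand mulrDr linearD th_aY psrD psrCM psrD mulrDr -addrA.
congr (_ + _).
(* [b] and [b'] have no constant term, so the first summand of each convolution drops and the rest
   match index by index. *)
rewrite psrM [X in _ * X + _]big_ord_recl psrD psrN ?b0 ?b'0 subr0 mul0r add0r.
rewrite psrM [X in _ = _ + X]big_ord_recl b'0 mul0r add0r.
rewrite mulr_sumr linear_sum mulr_sumr -big_split; apply: eq_bigr => i _.
rewrite th_aYa_tailY /= !(psrD, psrN) expr1.
rewrite /b /b' /psi_psr /psi_ser /distr /= /bump /= add1n subSS.
by congr (_ + _); rewrite -!mulrA mulrCA.
Qed.

Lemma psi_XY_tail : psi_psr (distr th (X * Y)) = E 0%N + E 1%N.
Proof.
apply/funext => -[|n].
  by rewrite psrD /E /= !mulr0 linear0 addr0.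
rewrite psrD /E expr0 expr1 mul1r -linearD -[X in th (X + _)]mul1r -mulrDl.
by rewrite [1 + _]addrC subrK /psi_psr /psi_ser /distr /= exprS mulrA.
Qed.

Let w := eta_psr (distr ps Y).
Let M k : psr K := comp_psr (fun n => th (a ^+ k * X ^+ n)) w.

Let w0 : w 0%N = 0. Proof. exact: eta_psr0. Qed.

(** From [X = 1 + a]: a^k X^(n+1) = a^k X^n + a^(k+1) X^n. *)
Lemma shifted_psi_succ k :
  comp_psr (fun n => th (a ^+ k * X ^+ n.+1)) w = M k + M k.+1.
Proof.
rewrite /M -comp_psrD; congr comp_psr; apply/funext => n; rewrite psrD.
rewrite -linearD [a ^+ k.+1]exprSr -mulrA -mulrDr; congr (th (_ * _)).
by rewrite exprS mulrBl mul1r addrC subrK.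
Qed.

(** Horner's rule gives [M k = t k + w * (M k + M k.+1)]; solving for [M k] means multiplying by
    [1 + b'], the inverse of [1 - w]. *)
Lemma shifted_psi_rec k : M k = psrC (t k) * (1 + b') + b' * M k.+1.
Proof.
have wb : w * (1 + b') = b' by exact: eta_psi.
have wb1 : (1 - w) * (1 + b') = 1 by exact: eta_psi_inv.
have eM : M k = psrC (t k) + w * (M k + M k.+1).
  rewrite {1}/M comp_psr_shift // expr0 mulr1; congr (_ + w * _).
  exact: shifted_psi_succ.
have e2 : (1 - w) * M k = psrC (t k) + w * M k.+1.
  by rewrite mulrBl mul1r {1}eM mulrDr addrA addrAC addrK.
rewrite -[LHS]mul1r -{1}wb1 mulrAC e2 mulrDl; congr (_ + _).
by rewrite mulrAC wb.
Qed.

(** From index 1 on, the recursions for [E] and [M] share the weights [t k.+1] and the ratio [b'];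
    they differ only in the source that [al] multiplies. *)
Let al := comp_psr (fun k => t k.+1) b'.

Lemma shifted_psi1 : M 1%N = al * (1 + b').
Proof.
by apply: (@comp_psr_rec _ _ (fun k => M k.+1)) => // k; exact: shifted_psi_rec.
Qed.

Lemma shifted_psi0 : M 0%N = (1 + b' * al) * (1 + b').
Proof.
rewrite shifted_psi_rec shifted_psi1 {1}/t expr0 th1 psrC1; ring.
Qed.

Lemma tail_moments1 : E 1%N = al * (b + (b - b') * E 1%N).
Proof.
by apply: (@comp_psr_rec _ _ (fun k => E k.+1)) => // k; exact: tail_moments_rec.
Qed.

Let H := comp_psr (fshift (eta_psr (distr th X))) w.

(** The identity for [eta / z] of [X], evaluated at [w], reads [H * M 0 = M 0 + M 1]; then [1 + b']
    cancels. *)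
Lemma eta_shift_at_eta : H * (1 + b' * al) = 1 + al + b' * al.
Proof.
apply: (@psr_mulIf _ (1 + b')); first exact: one_psi0.
have := congr1 (@comp_psr K ^~ w) (eta_shift_psi (distr th X)).
rewrite /= comp_psrM // -/H.
have -> : comp_psr (1 + psi_psr (distr th X)) w = M 0%N.
  congr comp_psr; apply/funext => n; rewrite psrD psr1 expr0 mul1r.
  by case: n => [|n]; rewrite ?expr0 ?th1 ?addr0 ?add0r.
have -> : comp_psr (fshift (psi_psr (distr th X))) w = M 0%N + M 1%N.
  rewrite -shifted_psi_succ; congr comp_psr; apply/funext => n.
  by rewrite expr0 mul1r.
rewrite shifted_psi0 shifted_psi1 => e.
transitivity (H * ((1 + b' * al) * (1 + b'))); first ring.
by rewrite e; ring.
Qed.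

Lemma eta_cmono_conds :
  eta_psr (distr th (X * Y)) = eta_psr (distr th Y) * H.
Proof.
apply: eta_psr_uniq; rewrite psi_XY_tail tail_moments0; set e1 := E 1%N.
have e1E : e1 = al * (b + (b - b') * e1) := tail_moments1.
have hE := eta_shift_at_eta.
have bE : eta_psr (distr th Y) * (1 + b) = b := eta_psi (distr th Y).
(* Here 1 + psi of [X * Y] is [(1 + b) * (1 + e1)]; the new factor [1 + b' * al] serves to eliminate
   [H] through [hE]. *)
apply: (@psr_mulIf _ (1 + b' * al)).
  by rewrite psrD psrM0 b'0 mul0r addr0.
transitivity ((eta_psr (distr th Y) * (1 + b)) * (H * (1 + b' * al)) * (1 + e1)).
  ring.
rewrite bE hE; apply/eqP; rewrite -subr_eq0; apply/eqP.
(* The difference of the two sides collapses to that of the equation [e1E]. *)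
transitivity (al * (b + (b - b') * e1) - e1); first ring.
by rewrite -e1E subrr.
Qed.

End MonotoneMoments.

Section FormalPart.
Variables (K : comNzRingType) (A : algType K) (phi psi : {scalar A}) (X Y : A).
Hypotheses (phi1 : phi 1 = 1) (psi1 : psi 1 = 1).
Hypothesis Hind : c_monotone_indep phi psi (X - 1) Y.

Lemma eta_c_monotone_conv : eta_psr (distr phi (X * Y)) =
  eta_psr (distr phi Y) *
  comp_psr (fshift (eta_psr (distr phi X))) (eta_psr (distr psi Y)).
Proof. exact: (eta_cmono_conds phi1 Hind.1). Qed.

(** With [psi] in both roles, Horner's rule absorbs the factor eta of [Y], since eta of [X] has no
    constant term. *)
Lemma eta_monotone_conv : eta_psr (distr psi (X * Y)) =
  comp_psr (eta_psr (distr psi X)) (eta_psr (distr psi Y)).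
Proof.
rewrite (eta_cmono_conds psi1 Hind.2) [RHS]comp_psr_shift ?eta_psr0 //.
by rewrite (_ : psrC 0 = 0) ?add0r //; apply/funext => -[].
Qed.

End FormalPart.

(** * Contractivity of eta for measures on the circle *)

Section Contraction.
Variable R : realType.
Local Notation C := R[i].
Local Notation cRe := (@complex.Re R).
Local Notation cIm := (@complex.Im R).
Local Open Scope complex_scope.

Lemma cReD (x y : C) : cRe (x + y) = cRe x + cRe y.
Proof. by case: x y => [a b] [c d]. Qed.
Lemma cImD (x y : C) : cIm (x + y) = cIm x + cIm y.
Proof. by case: x y => [a b] [c d]. Qed.
Lemma cRe_sum (I : Type) (r : seq I) (P : pred I) (F : I -> C) :
  cRe (\sum_(i <- r | P i) F i) = \sum_(i <- r | P i) cRe (F i).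
Proof. by apply: (big_morph cRe cReD). Qed.
Lemma cIm_sum (I : Type) (r : seq I) (P : pred I) (F : I -> C) :
  cIm (\sum_(i <- r | P i) F i) = \sum_(i <- r | P i) cIm (F i).
Proof. by apply: (big_morph cIm cImD). Qed.

Definition sqn (x : C) : R := cRe x ^+ 2 + cIm x ^+ 2.

Lemma sqn_ge0 x : 0 <= sqn x. Proof. by rewrite addr_ge0 ?sqr_ge0. Qed.

Lemma sqn0 : sqn 0 = 0. Proof. by rewrite /sqn /= expr0n addr0. Qed.

Lemma sqnM x y : sqn (x * y) = sqn x * sqn y.
Proof. by case: x y => [a b] [c d]; rewrite /sqn /=; ring. Qed.

(** This converts positivity of a real part into a comparison of norms. *)
Lemma Re_conjB_mulD (x y : C) : cRe (conjc (x - y) * (x + y)) = sqn x - sqn y.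
Proof. by case: x y => [a b] [c d]; rewrite /sqn /=; ring. Qed.

(** The norms are truncated, so [u] can be any series and no convergence enters. *)
Definition contraction (f : psr C) := forall (u : psr C) N,
  \sum_(n < N) sqn ((f * u) n) <= \sum_(n < N) sqn (u n).

Lemma contractionX (f : psr C) k : contraction f -> contraction (f ^+ k).
Proof.
move=> cf; elim: k => [|k IHk] u N; first by rewrite mul1r.
by rewrite exprS -mulrA (le_trans (cf _ _)).
Qed.

(** The series 1 has norm 1, and [sqn (f n)] is one summand of the norm of its image. *)
Lemma contraction_coef (f : psr C) n : contraction f -> sqn (f n) <= 1.
Proof.
move=> /(_ 1 n.+1); rewrite mulr1 [leRHS]big_ord_recl [X in _ + X]big1 => [|i _].
  rewrite psr1 /sqn /= expr1n expr0n /= !addr0; apply: le_trans.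
  by rewrite big_ord_recr /= lerDr sumr_ge0 // => i _; exact: sqn_ge0.
by rewrite psr1 sqn0.
Qed.

(* Positivity of the real part of [1 + 2 psi], in truncated form. *)
Definition caratheodory (p : psr C) := forall (w : psr C) N,
  0 <= \sum_(n < N) cRe (conjc (w n) * ((1 + p *+ 2) * w) n).

(** Cayley transform: multiplication by [1 + 2 psi] sends the test vector [(1 - eta) * u] to
    [(1 + eta) * u]. *)
Lemma caratheodory_contraction (m : nat -> C) :
  caratheodory (psi_psr m) -> contraction (eta_psr m).
Proof.
move=> pos u N; have := pos ((1 - eta_psr m) * u) N.
rewrite mulrA (_ : (1 + _) * (1 - eta_psr m) = 1 + eta_psr m); last first.
  have := eta_psi_inv m => e.
  transitivity (((1 - eta_psr m) * (1 + psi_psr m)) *+ 2 - 1 + eta_psr m); first ring.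
  by rewrite e; ring.
rewrite mulrBl mulrDl mul1r.
under eq_bigr => n _ do rewrite !psrD psrN Re_conjB_mulD.
by rewrite sumrB subr_ge0.
Qed.

(** The case of a point mass at [x]. As [1 + p] is 1 / (1 - x z), one has w = s - x z s and (1 + 2
    p) w = s + x z s, so the sum telescopes to the last squared modulus of [s]. *)
Lemma caratheodory_point (x : C) : sqn x = 1 ->
  caratheodory (psi_psr (fun n => x ^+ n)).
Proof.
move=> x1 w N; set p := psi_psr _.
pose s := (1 + p) * w; pose s' := psrC x * (psr_z C * s).
have gE : 1 + p = 1 + psrC x * (psr_z C * (1 + p)).
  apply/funext => -[|n]; rewrite !psrD psrCM ?psr_zM0 ?psr_zMS ?mulr0 //.
  rewrite psrD psr1 /=; case: n => [|n]; rewrite /p /psi_psr /psi_ser /=.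
    by rewrite expr1 addr0 mulr1.
  by rewrite psr1 !add0r exprS.
have sE : s = w + s'.
  by rewrite /s {1}gE /s' /s; ring.
have -> : (1 + p *+ 2) * w = s + s'.
  rewrite (_ : s' = s - w); last by rewrite sE addrC addKr.
  by rewrite /s; ring.
have wE n : w n = s n - s' n by rewrite sE psrD addrK.
have s'E n : sqn (s' n) = sqn ((psr_z C * s) n) by rewrite /s' psrCM sqnM x1 mul1r.
under eq_bigr => n _ do rewrite wE psrD Re_conjB_mulD s'E.
case: N => [|N]; first by rewrite big_ord0.
rewrite sumrB [X in _ - X]big_ord_recl psr_zM0.
under [X in _ - (_ + X)]eq_bigr => i _ do rewrite psr_zMS.
rewrite [X in X - _]big_ord_recr /= sqn0 add0r addrAC subrr add0r.
exact: sqn_ge0.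
Qed.

Lemma deMoivre (x : R) n : (cos x +i* sin x) ^+ n = cos (n%:R * x) +i* sin (n%:R * x).
Proof.
elim: n => [|n IHn]; first by rewrite mul0r cos0 sin0.
rewrite exprS IHn -natr1 mulrDl mul1r addrC cosD sinD /=.
by apply/eqP; rewrite eq_complex /=; apply/andP; split; apply/eqP; ring.
Qed.

Section Moments.
Variable P : probability R R.

(** Carrying integrability along with the value lets finite linear combinations be integrated in one
    go. *)
Let Int (f : R -> R) (v : R) :=
  P.-integrable setT (EFin \o f) /\ Rintegral P setT f = v.

Let Int_add f g u v : Int f u -> Int g v -> Int (fun x => f x + g x) (u + v).
Proof.
move=> [fi <-] [gi <-]; split; last by rewrite RintegralD.
by rewrite (_ : _ \o _ = (EFin \o f) \+ (EFin \o g))%E //; exact: integrableD.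
Qed.

Let Int_scale f r u : Int f u -> Int (fun x => r * f x) (r * u).
Proof.
move=> [fi <-]; split; last by rewrite RintegralZl.
by rewrite (_ : _ \o _ = (fun x => r%:E * (EFin \o f) x)%E) //; exact: integrableZl.
Qed.

Let Int_bounded f : continuous f -> (forall x, `|f x| <= 1) -> Int f (Rintegral P setT f).
Proof.
move=> cf bf; split => //; apply: measurable_bounded_integrable => //.
- by apply: (le_lt_trans (probability_le1 P measurableT)); rewrite ltry.
- exact: measurable_realfun.continuous_measurable_fun.
- exists 1; split => // x x1 y _; exact: le_trans (bf y) (ltW x1).
Qed.

Let Int_cst r : Int (fun=> r) r.
Proof.
have [i1 _] : Int (fun=> 1) (Rintegral P setT (fun=> 1)).
  by apply: Int_bounded => x; [exact: cvg_cst|rewrite normr1].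
have e1 : Int (fun=> 1) 1.
  split => //; rewrite Rintegral_cst // mul1r -[RHS]/(fine 1%E).
  congr fine; exact: probability_setT.
by have := Int_scale r e1; rewrite mulr1.
Qed.

Let Int_sum n (f : nat -> R -> R) (v : nat -> R) : (forall i, Int (f i) (v i)) ->
  Int (fun x => \sum_(i < n) f i x) (\sum_(i < n) v i).
Proof.
move=> fv; elim: n => [|n IHn].
  rewrite big_ord0 (_ : (fun x => _) = fun=> 0); first exact: Int_cst.
  by apply/funext => x; rewrite big_ord0.
rewrite big_ord_recr (_ : (fun x => _) = fun x => \sum_(i < n) f i x + f n x).
  exact: Int_add.
by apply/funext => x; rewrite big_ord_recr.
Qed.

Variable m : nat -> C.
Hypothesis mE : forall n, m n = (Rintegral P setT (fun t => cos (n%:R * t)))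
             +i* (Rintegral P setT (fun t => sin (n%:R * t))).

Let Int_moment (c : C) k :
  Int (fun x => cRe (c * (cos x +i* sin x) ^+ k)) (cRe (c * m k)).
Proof.
have lin : continuous (fun x : R => k%:R * x).
  exact: mulrl_continuous.
have ci : Int (fun x => cos (k%:R * x)) (cRe (m k)).
  rewrite mE; apply: Int_bounded => [x|x]; last by rewrite cos_max.
  by apply: continuous_comp; [exact: lin|exact: continuous_cos].
have si : Int (fun x => sin (k%:R * x)) (cIm (m k)).
  rewrite mE; apply: Int_bounded => [x|x]; last by rewrite sin_max.
  by apply: continuous_comp; [exact: lin|exact: continuous_sin].
have := Int_add (Int_scale (cRe c) ci) (Int_scale (- cIm c) si).
rewrite (_ : cRe (c * m k) = cRe c * cRe (m k) + - cIm c * cIm (m k)); last first.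
  by rewrite mulNr; case: (c) (m k) => [? ?] [? ?].
rewrite (_ : (fun x => cRe c * _ + _) = fun x => cRe (c * (cos x +i* sin x) ^+ k)) //.
by apply/funext => x; rewrite deMoivre mulNr; case: (c) => [? ?].
Qed.

(** The summand of the positivity form, arranged as a constant plus a real-linear expression in the
    moments [l]. *)
Let form (w : psr C) (l : nat -> C) n : R :=
  cRe (conjc (w n) * w n) +
  \sum_(i < n) cRe (conjc (w n) * w (n - i.+1)%N *+ 2 * l i.+1).

Let formE w l n :
  cRe (conjc (w n) * ((1 + psi_psr l *+ 2) * w) n) = form w l n.
Proof.
rewrite mulrDl mul1r psrD mulrDr cReD; congr (_ + _).
rewrite psrM big_ord_recl (_ : (psi_psr l *+ 2) _ = 0); last first.
  by rewrite mulr2n psrD psi_psr0 addr0.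
rewrite mul0r add0r mulr_sumr cRe_sum; apply: eq_bigr => i _.
by congr cRe; rewrite /= mulr2n psrD /psi_psr /psi_ser /= /bump /= add1n; ring.
Qed.

(** The form for [m] is the integral over [P] of the forms for point masses at e^(ix), each
    nonnegative. *)
Lemma caratheodory_moments : caratheodory (psi_psr m).
Proof.
move=> w N; under eq_bigr => n _ do rewrite formE.
have [_ <-] : Int (fun x => \sum_(n < N) form w (fun k => (cos x +i* sin x) ^+ k) n)
  (\sum_(n < N) form w m n).
  apply: (@Int_sum _ (fun n x => form w (fun k => (cos x +i* sin x) ^+ k) n)) => n.
  apply: Int_add; first exact: Int_cst.
  pose c i := conjc (w n) * w (n - i.+1)%N *+ 2.
  apply: (@Int_sum _ (fun i x => cRe (c i * (cos x +i* sin x) ^+ i.+1))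
    (fun i => cRe (c i * m i.+1))).
  by move=> i; exact: Int_moment.
apply: Rintegral_ge0 => x _; under eq_bigr => n _ do rewrite -formE.
by apply: caratheodory_point; rewrite /sqn /= cos2Dsin2.
Qed.

End Moments.

Lemma circle_contraction (m : nat -> C) : circle_moments m -> contraction (eta_psr m).
Proof.
by move=> [P mE]; apply/caratheodory_contraction/(@caratheodory_moments P).
Qed.

Lemma contraction_shift (m : nat -> C) :
  contraction (eta_psr m) -> contraction (fshift (eta_psr m)).
Proof.
(* Cutting [u] at [N] keeps the first [N] output coefficients and kills the extra input term when
   [ce] is used at length [N.+1]. *)
move=> ce u N; pose v : psr C := fun n => if (n < N)%N then u n else 0.
have vu i : (i < N)%N -> v i = u i by rewrite /v => ->.
have vN : v N = 0 by rewrite /v ltnn.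
have <- : \sum_(n < N) sqn (v n) = \sum_(n < N) sqn (u n).
  by apply: eq_bigr => i _; rewrite vu.
have <- : \sum_(n < N) sqn (((fshift (eta_psr m) : psr C) * v) n) =
          \sum_(n < N) sqn (((fshift (eta_psr m) : psr C) * u) n).
  apply: eq_bigr => i _; congr sqn; rewrite !psrM; apply: eq_bigr => j _.
  by rewrite vu //; have := ltn_ord i; have := ltn_ord j; lia.
have := ce v N.+1; rewrite {1}eta_shift -mulrA big_ord_recl psr_zM0 sqn0 add0r.
under eq_bigr => i _ do rewrite psr_zMS.
by rewrite [X in _ <= X -> _]big_ord_recr /= vN sqn0 addr0.
Qed.

End Contraction.

(** * Series converging on the unit disc *)

Lemma triangular_sum (K : comNzRingType) (a b : psr K) N :
  \sum_(k < N) (a * b) k = \sum_(i < N) a i * \sum_(j < N - i) b j.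
Proof.
elim: N => [|N IHN]; first by rewrite !big_ord0.
rewrite big_ord_recr IHN [RHS]big_ord_recr /= psrM [X in _ + X]big_ord_recr /=.
rewrite addrA -big_split; congr (_ + _).
  apply: eq_bigr => i _ /=; rewrite -mulrDr subSn 1?ltnW //.
  by rewrite [in RHS]big_ord_recr.
by rewrite subnn subSnn big_ord_recl big_ord0 addr0.
Qed.

Section Majorants.
Variable R : realType.
Implicit Types A B : psr R.

(* Power series with nonnegative coefficients and radius of convergence at least 1. *)
Definition disc_majorant A := (forall n, 0 <= A n) /\
  forall r, 0 <= r < 1 -> exists M, forall N, \sum_(k < N) A k * r ^+ k <= M.

Lemma disc_majorant_le A B : disc_majorant B -> (forall n, 0 <= A n <= B n) ->
  disc_majorant A.
Proof.
move=> [_ Bs] AB; split=> [n|r r01]; first by case/andP: (AB n).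
have [M BM] := Bs _ r01; exists M => N; apply: le_trans (BM N).
apply: ler_sum => k _; apply: ler_wpM2r; last by case/andP: (AB k).
by case/andP: r01 => r0 _; exact: exprn_ge0.
Qed.

Lemma disc_majorant_cst (c : R) : 0 <= c -> disc_majorant (fun=> c).
Proof.
move=> c0; split=> // r /andP[r0 r1]; exists (c / (1 - r)) => N.
have r1' : 0 < 1 - r by rewrite subr_gt0.
rewrite ler_pdivlMr //.
have -> : (\sum_(k < N) c * r ^+ k) * (1 - r) = c * (1 - r ^+ N).
  elim: N => [|N IHN]; first by rewrite big_ord0 mul0r expr0 subrr mulr0.
  by rewrite big_ord_recr /= mulrDl IHN exprS; ring.
by rewrite ler_piMr // gerBl exprn_ge0.
Qed.

Lemma sum_ge0_le_widen (b : nat -> R) m n : (forall k, 0 <= b k) -> (m <= n)%N ->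
  \sum_(k < m) b k <= \sum_(k < n) b k.
Proof.
move=> b0 /subnK <-; elim: (n - m)%N => [|d IHd] //.
by rewrite addSn big_ord_recr /= (le_trans IHd) // lerDl.
Qed.

Lemma sum_ge0_term (b : nat -> R) n : (forall k, 0 <= b k) ->
  b n <= \sum_(k < n.+1) b k.
Proof. by move=> b0; rewrite big_ord_recr /= lerDr sumr_ge0. Qed.

Lemma disc_majorantM A B : disc_majorant A -> disc_majorant B -> disc_majorant (A * B).
Proof.
move=> [A0 As] [B0 Bs]; split=> [n|r r01].
  by rewrite psrM sumr_ge0 // => i _; exact: mulr_ge0.
have r0 k : 0 <= r ^+ k by case/andP: r01 => r0 _; exact: exprn_ge0.
have [[MA AM] [MB BM]] := (As _ r01, Bs _ r01).
exists (MA * MB) => N.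
pose A' : psr R := fun k => A k * r ^+ k; pose B' : psr R := fun k => B k * r ^+ k.
have A'0 k : 0 <= A' k by exact: mulr_ge0.
have B'0 k : 0 <= B' k by exact: mulr_ge0.
have -> : \sum_(k < N) (A * B) k * r ^+ k = \sum_(k < N) (A' * B') k.
  apply: eq_bigr => k _; rewrite !psrM mulr_suml; apply: eq_bigr => i _.
  have -> : r ^+ k = r ^+ i * r ^+ (k - i) by rewrite -exprD subnKC // -ltnS.
  by rewrite /A' /B'; ring.
rewrite triangular_sum.
have MB0 : 0 <= MB by have := BM 0%N; rewrite big_ord0.
apply: le_trans (_ : (\sum_(i < N) A' i) * MB <= _).
  rewrite mulr_suml; apply: ler_sum => i _; apply: ler_wpM2l => //; exact: BM.
by apply: ler_wpM2r => //; exact: AM.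
Qed.

(** At radius [sqrt r] the terms of [A] are bounded and those of [B] summable; their products are
    the terms at radius [r]. *)
Lemma disc_majorant_pointwise A B : disc_majorant A -> disc_majorant B ->
  disc_majorant (fun n => A n * B n).
Proof.
move=> [A0 As] [B0 Bs]; split=> [n|r /andP[r0 r1]]; first exact: mulr_ge0.
pose s := Num.sqrt r.
have s01 : 0 <= s < 1 by rewrite sqrtr_ge0 -sqrtr1 ltr_sqrt.
have s0 k : 0 <= s ^+ k by case/andP: s01 => ? _; exact: exprn_ge0.
have [[MA AM] [MB BM]] := (As _ s01, Bs _ s01).
exists (MA * MB) => N.
have MA0 : 0 <= MA by have := AM 0%N; rewrite big_ord0.
apply: le_trans (_ : MA * (\sum_(k < N) B k * s ^+ k) <= _); last first.
  by apply: ler_wpM2l.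
rewrite mulr_sumr; apply: ler_sum => k _.
have -> : A k * B k * r ^+ k = (A k * s ^+ k) * (B k * s ^+ k).
  by rewrite -{1}(sqr_sqrtr r0) -/s exprAC; ring.
apply: ler_wpM2r; first exact: mulr_ge0.
apply: le_trans (AM k.+1).
by apply: (@sum_ge0_term (fun k => A k * s ^+ k)) => j; exact: mulr_ge0.
Qed.

(** These are the coefficients of the square of the geometric series. *)
Lemma disc_majorantS : disc_majorant (fun n => n.+1%:R).
Proof.
have c1 := disc_majorant_cst (@ler01 R).
have := disc_majorantM c1 c1; congr disc_majorant.
apply/funext => n; rewrite psrM (eq_bigr (fun=> 1)) => [|i _]; last by rewrite mulr1.
by rewrite sumr_const card_ord.
Qed.

Lemma disc_majorantD A B : disc_majorant A -> disc_majorant B -> disc_majorant (A + B).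
Proof.
move=> [A0 As] [B0 Bs]; split=> [n|r r01]; first by rewrite psrD addr_ge0.
have [[MA AM] [MB BM]] := (As _ r01, Bs _ r01); exists (MA + MB) => N.
under eq_bigr => k _ do rewrite psrD mulrDl.
by rewrite big_split /=; apply: lerD; [exact: AM|exact: BM].
Qed.

Lemma bounded_sum_tail (b : nat -> R) M : (forall k, 0 <= b k) ->
  (forall N, \sum_(k < N) b k <= M) ->
  forall e, 0 < e -> exists K, forall k N, (K <= k)%N ->
    \sum_(i < N) b i - \sum_(i < k) b i < e.
Proof.
move=> b0 bM e e0; pose t N := \sum_(i < N) b i.
have tnd : nondecreasing_seq t by move=> m n; exact: sum_ge0_le_widen.
have tc : cvgn t.
  by apply: nondecreasing_is_cvgn => //; exists M => _ [n _ <-]; exact: bM.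
have /cvgrPdist_lt/(_ _ e0)[K _ KP] := tc.
exists K => k N /KP /= tk; apply: le_lt_trans tk.
apply: le_trans (ler_norm _); apply: lerB => //.
exact: nondecreasing_cvgn_le.
Qed.

End Majorants.

(** * Convergence of complex series *)

Section ComplexSeries.
Variable R : realType.
Local Notation C := R[i].
Local Notation cRe := (@complex.Re R).
Local Notation cIm := (@complex.Im R).
Local Open Scope complex_scope.

Definition cabs (x : C) : R := Normc.normc x.

Lemma complex_normE (x : C) : `|x| = (cabs x)%:C. Proof. by []. Qed.
Lemma cabsE x : cabs x = Num.sqrt (sqn x). Proof. by case: x. Qed.
Lemma cabs_ge0 x : 0 <= cabs x. Proof. by rewrite cabsE sqrtr_ge0. Qed.
Local Hint Resolve cabs_ge0 : core.
Lemma cabsM x y : cabs (x * y) = cabs x * cabs y. Proof. exact: Normc.normcM. Qed.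
Lemma cabsD x y : cabs (x + y) <= cabs x + cabs y. Proof. exact: le_normcD. Qed.
Lemma cabsN x : cabs (- x) = cabs x. Proof. exact: normcN. Qed.
Lemma cabs0 : cabs 0 = 0. Proof. exact: Normc.normc0. Qed.
Lemma cabs1 : cabs 1 = 1. Proof. exact: Normc.normc1. Qed.
Lemma cabsX x n : cabs (x ^+ n) = cabs x ^+ n.
Proof. by elim: n => [|n IHn]; rewrite ?cabs1 // !exprS cabsM IHn. Qed.
Lemma cabsB x y : cabs (x - y) = cabs (y - x). Proof. by rewrite -cabsN opprB. Qed.
Lemma cabs_sum (I : Type) (r : seq I) (P : pred I) (F : I -> C) :
  cabs (\sum_(i <- r | P i) F i) <= \sum_(i <- r | P i) cabs (F i).
Proof.
elim/big_rec2: _ => [|i y x _ le_xy]; first by rewrite cabs0.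
by apply: le_trans (cabsD _ _) _; rewrite lerD2l.
Qed.
Lemma cabs_Re x : `|cRe x| <= cabs x.
Proof. by rewrite cabsE -sqrtr_sqr ler_wsqrtr // lerDl sqr_ge0. Qed.
Lemma cabs_Im x : `|cIm x| <= cabs x.
Proof. by rewrite cabsE -sqrtr_sqr ler_wsqrtr // lerDr sqr_ge0. Qed.
Lemma cabs_le_ReIm x : cabs x <= `|cRe x| + `|cIm x|.
Proof.
rewrite cabsE -[leRHS]ger0_norm ?addr_ge0 // -sqrtr_sqr ler_wsqrtr //.
rewrite /sqn -[cRe x ^+ 2]real_normK ?num_real // -[cIm x ^+ 2]real_normK ?num_real //.
by rewrite sqrrD lerD2r lerDl mulrn_wge0 // mulr_ge0.
Qed.
Lemma cabs_le1 x : sqn x <= 1 -> cabs x <= 1.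
Proof. by move=> x1; rewrite cabsE -sqrtr1 ler_wsqrtr. Qed.

Definition ccvg (u : nat -> C) (l : C) :=
  forall e : R, 0 < e -> exists N, forall n, (N <= n)%N -> cabs (u n - l) < e.

Lemma ccvgD u v k l : ccvg u k -> ccvg v l -> ccvg (fun n => u n + v n) (k + l).
Proof.
move=> uk vl e e0; have e2 : 0 < e / 2 by rewrite divr_gt0.
have [[N NP] [M MP]] := (uk _ e2, vl _ e2); exists (maxn N M) => n.
rewrite geq_max => /andP[/NP un /MP vn].
have -> : u n + v n - (k + l) = (u n - k) + (v n - l) by ring.
by rewrite (splitr e) (le_lt_trans (cabsD _ _)) // ltrD.
Qed.

Lemma ccvgMl u l x : ccvg u l -> ccvg (fun n => x * u n) (x * l).
Proof.
move=> ul e e0; have x1 : 0 < cabs x + 1 by rewrite ltr_wpDl.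
have [N NP] := ul (e / (cabs x + 1)) (divr_gt0 e0 x1); exists N => n /NP.
rewrite -mulrBr cabsM ltr_pdivlMr // mulrC; apply: le_lt_trans.
by apply: ler_wpM2r => //; rewrite lerDl.
Qed.

Lemma ccvg_near u v l : ccvg u l -> ccvg (fun n => v n - u n) 0 -> ccvg v l.
Proof.
move=> ul vu; have := ccvgD ul vu; rewrite addr0 /=; congr ccvg.
by apply/funext => n; rewrite addrC subrK.
Qed.

Lemma ccvg_bound u l M : ccvg u l -> (forall n, cabs (u n) <= M) -> cabs l <= M.
Proof.
move=> ul uM; rewrite leNgt; apply/negP => lM.
have [|N /(_ N (leqnn N))] := ul (cabs l - M); first by rewrite subr_gt0.
have := cabsD (u N) (l - u N); rewrite [u N + _]addrC subrK cabsB.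
by have := uM N; lra.
Qed.

Lemma ccvg_uniq u k l : ccvg u k -> ccvg u l -> k = l.
Proof.
move=> uk ul; apply/eqP; rewrite -subr_eq0; apply/eqP/Normc.eq0_normc.
have := ccvgD uk (ccvgMl (-1) ul); rewrite mulN1r => kl.
apply/eqP; rewrite eq_le; apply/andP; split; last exact: cabs_ge0.
by apply: (ccvg_bound kl) => n; rewrite mulN1r subrr cabs0.
Qed.

Lemma cvgn_abs_bounded (u : nat -> R) M : (forall N, \sum_(k < N) `|u k| <= M) ->
  cvgn (fun N => \sum_(k < N) u k).
Proof.
move=> uM; have -> : (fun N => \sum_(k < N) u k) = series u.
  by apply/funext => N; rewrite /series /= big_mkord.
apply: normed_cvg; apply: nondecreasing_is_cvgn.
  by apply: nondecreasing_series => n _ _; exact: normr_ge0.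
by exists M => _ [n _ <-]; rewrite /= /series /= big_mkord.
Qed.

Definition abs_summable (a : nat -> C) :=
  exists M, forall N, \sum_(k < N) cabs (a k) <= M.

(** Absolute summability passes to real and imaginary parts; the limit is spelled as in
    [ser_value]. *)
Lemma abs_summable_ccvg (a : nat -> C) : abs_summable a ->
  ccvg (fun N => \sum_(k < N) a k)
    (limn (fun N => cRe (\sum_(k < N) a k)) +i* limn (fun N => cIm (\sum_(k < N) a k))).
Proof.
move=> [M aM].
have cr : cvgn (fun N => cRe (\sum_(k < N) a k)).
  rewrite (_ : (fun N => _) = fun N => \sum_(k < N) cRe (a k)); last first.
    by apply/funext => N; rewrite cRe_sum.
  apply: (@cvgn_abs_bounded (fun k => cRe (a k)) M) => N; apply: le_trans (aM N).
  by apply: ler_sum => k _; exact: cabs_Re.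
have ci : cvgn (fun N => cIm (\sum_(k < N) a k)).
  rewrite (_ : (fun N => _) = fun N => \sum_(k < N) cIm (a k)); last first.
    by apply/funext => N; rewrite cIm_sum.
  apply: (@cvgn_abs_bounded (fun k => cIm (a k)) M) => N; apply: le_trans (aM N).
  by apply: ler_sum => k _; exact: cabs_Im.
move=> e e0; have e2 : 0 < e / 2 by rewrite divr_gt0.
have /cvgrPdist_lt/(_ _ e2)[N _ NP] := cr.
have /cvgrPdist_lt/(_ _ e2)[N' _ N'P] := ci.
exists (maxn N N') => n; rewrite geq_max => /andP[/NP /= rn /N'P /= im].
rewrite cabsB (le_lt_trans (cabs_le_ReIm _)) // (splitr e).
move: rn im; case: (\sum_(k < n) a k) => /= p q rn im; exact: ltrD.
Qed.

(** Mertens' argument: compared with [l] times the partial sum of [a], the error splits at an index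
    [L]. Below it the inner sums of [b] are close to [l]; above it the tail of [a] is small. *)
Lemma ccvg_cauchy_product (a b : psr C) k l : abs_summable a -> abs_summable b ->
  ccvg (fun N => \sum_(i < N) a i) k -> ccvg (fun N => \sum_(i < N) b i) l ->
  ccvg (fun N => \sum_(i < N) (a * b) i) (k * l).
Proof.
move=> [MA aM] [MB bM] ak bl.
apply: (@ccvg_near (fun N => (\sum_(i < N) a i) * l)).
  have := ccvgMl l ak; rewrite mulrC; congr ccvg.
  by apply/funext => n; rewrite mulrC.
have MA0 : 0 <= MA by have := aM 0%N; rewrite big_ord0.
have MB0 : 0 <= MB by have := bM 0%N; rewrite big_ord0.
(* [D] collects the factors of [d] in the two estimates, plus 1 for strictness. *)
move=> e e0; pose D := MA + (MB + cabs l) + 1.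
have D0 : 0 < D by rewrite /D ltr_wpDl // !addr_ge0.
pose d := e / D; have d0 : 0 < d by exact: divr_gt0.
have [K KP] := bl d d0.
have [L LP] := bounded_sum_tail (fun k => cabs_ge0 (a k)) aM d0.
(* With this threshold the inner length [n - i] is at least [K] for every [i < L]. *)
exists (K + L)%N => n Kn; rewrite subr0 triangular_sum mulr_suml -sumrB.
apply: le_lt_trans (cabs_sum _ _ _) _.
under eq_bigr => i _ do rewrite -mulrBr cabsM.
have Ln : (L <= n)%N by lia.
rewrite -(big_mkord predT (fun i => cabs (a i) * cabs (\sum_(j < n - i) b j - l))).
rewrite (@big_cat_nat _ _ _ L) //= !big_mkord.
have part1 : \sum_(i < L) cabs (a i) * cabs (\sum_(j < n - i) b j - l) <= MA * d.
  apply: le_trans (_ : \sum_(i < L) cabs (a i) * d <= _).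
    apply: ler_sum => i _; apply: ler_wpM2l => //; apply/ltW/KP.
    by have := ltn_ord i; lia.
  by rewrite -mulr_suml; apply: ler_wpM2r; [exact: ltW|exact: aM].
have part2 : \sum_(L <= i < n) cabs (a i) * cabs (\sum_(j < n - i) b j - l)
    <= d * (MB + cabs l).
  apply: le_trans (_ : \sum_(L <= i < n) cabs (a i) * (MB + cabs l) <= _).
    apply: ler_sum => i _; apply: ler_wpM2l => //.
    rewrite (le_trans (cabsD _ _)) // cabsN lerD2r.
    by apply: le_trans (cabs_sum _ _ _) _; exact: bM.
  rewrite -mulr_suml; apply: ler_wpM2r; first exact: addr_ge0.
  apply/ltW; have := LP L n (leqnn L); apply: le_lt_trans.
  have -> : \sum_(i < n) cabs (a i) =
      \sum_(i < L) cabs (a i) + \sum_(L <= i < n) cabs (a i).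
    by rewrite -!(big_mkord predT (fun i => cabs (a i))) -big_cat_nat.
  by rewrite addrAC subrr add0r.
apply: le_lt_trans (lerD part1 part2) _.
have -> : e = d * D by rewrite /d divfK // gt_eqF.
by rewrite /D; nra.
Qed.

Implicit Types (a b f g h : psr C) (z w : C).

(** * Evaluation at points of the open unit disc *)

Definition disc_summable a := disc_majorant (fun n => cabs (a n)).

Lemma disc_summable_le a (A : psr R) :
  disc_majorant A -> (forall n, cabs (a n) <= A n) -> disc_summable a.
Proof. by move=> hA aA; apply: disc_majorant_le hA _ => n; rewrite cabs_ge0 aA. Qed.

Lemma disc_summable_bounded a (c : R) : (forall n, cabs (a n) <= c) -> disc_summable a.
Proof.
move=> ac; apply: (disc_summable_le _ ac); apply: disc_majorant_cst.
exact: le_trans (cabs_ge0 _) (ac 0%N).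
Qed.

Lemma disc_summableM a b : disc_summable a -> disc_summable b -> disc_summable (a * b).
Proof.
move=> ha hb; apply: disc_summable_le (disc_majorantM ha hb) _ => n.
rewrite !psrM; apply: le_trans (cabs_sum _ _ _) _.
by apply: ler_sum => i _; rewrite cabsM.
Qed.

Lemma disc_summableD a b : disc_summable a -> disc_summable b -> disc_summable (a + b).
Proof.
by move=> ha hb; apply: disc_summable_le (disc_majorantD ha hb) _ => n; exact: cabsD.
Qed.

Lemma disc_summableN a : disc_summable a -> disc_summable (- a).
Proof. by move=> ha; apply: disc_summable_le ha _ => n; rewrite psrN cabsN. Qed.

Lemma disc_summableC (c : C) : disc_summable (psrC c).
Proof.
apply: (@disc_summable_bounded _ (cabs c)) => n; rewrite /psrC.
by case: eqP => // _; rewrite cabs0 ?cabs_ge0.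
Qed.

Lemma disc_summable_z : disc_summable (psr_z C).
Proof.
apply: (@disc_summable_bounded _ 1) => n; rewrite /psr_z.
by case: eqP => _; rewrite ?cabs1 ?cabs0.
Qed.

Definition scale_psr z a : psr C := fun n => a n * z ^+ n.

Lemma scale_psrM z a b : scale_psr z (a * b) = scale_psr z a * scale_psr z b.
Proof.
apply/funext => n; rewrite /scale_psr !psrM mulr_suml; apply: eq_bigr => i _.
have -> : z ^+ n = z ^+ i * z ^+ (n - i) by rewrite -exprD subnKC // -ltnS.
ring.
Qed.

Section Value.
Variable z : C.
Hypothesis z1 : cabs z < 1.

Lemma disc_abs_summable a : disc_summable a -> abs_summable (scale_psr z a).
Proof.
move=> [_ /(_ (cabs z))[|M aM]]; first by rewrite cabs_ge0.
exists M => N; apply: le_trans (aM N).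
by apply: ler_sum => k _; rewrite /scale_psr cabsM cabsX.
Qed.

Lemma ser_value_ccvg a : disc_summable a ->
  ccvg (fun N => \sum_(k < N) scale_psr z a k) (ser_value a z).
Proof. by move=> ha; exact: abs_summable_ccvg (disc_abs_summable ha). Qed.

Lemma ser_valueM a b : disc_summable a -> disc_summable b ->
  ser_value (a * b) z = ser_value a z * ser_value b z.
Proof.
move=> ha hb; apply: ccvg_uniq (ser_value_ccvg (disc_summableM ha hb)) _.
rewrite scale_psrM; apply: ccvg_cauchy_product; do ?exact: ser_value_ccvg.
all: exact: disc_abs_summable.
Qed.

Lemma ser_valueD a b : disc_summable a -> disc_summable b ->
  ser_value (a + b) z = ser_value a z + ser_value b z.
Proof.
move=> ha hb; apply: ccvg_uniq (ser_value_ccvg (disc_summableD ha hb)) _.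
have := ccvgD (ser_value_ccvg ha) (ser_value_ccvg hb); congr ccvg.
apply/funext => N; rewrite -big_split; apply: eq_bigr => i _.
by rewrite /scale_psr psrD mulrDl.
Qed.

Lemma ser_valueC (c : C) : ser_value (psrC c) z = c.
Proof.
apply: ccvg_uniq (ser_value_ccvg (disc_summableC c)) _ => e e0.
exists 1%N => -[//|n] _; rewrite big_ord_recl /scale_psr /= expr0 mulr1 big1.
  by rewrite addr0 subrr cabs0.
by move=> i _; rewrite /psrC /= mul0r.
Qed.

Lemma ser_value_z : ser_value (psr_z C) z = z.
Proof.
apply: ccvg_uniq (ser_value_ccvg disc_summable_z) _ => e e0.
exists 2%N => -[//|[//|n]] _; rewrite 2!big_ord_recl /scale_psr /psr_z /=.
rewrite expr1 mul1r mul0r add0r big1; first by rewrite addr0 subrr cabs0.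
by move=> i _; rewrite mul0r.
Qed.

Lemma disc_summableX a k : disc_summable a -> disc_summable (a ^+ k).
Proof.
move=> ha; elim: k => [|k IHk]; first exact: disc_summableC.
by rewrite exprS; exact: disc_summableM.
Qed.

Lemma ser_valueX a k : disc_summable a -> ser_value (a ^+ k) z = ser_value a z ^+ k.
Proof.
move=> ha; elim: k => [|k IHk]; first by rewrite expr0 -psrC1 ser_valueC.
by rewrite !exprS ser_valueM ?IHk //; exact: disc_summableX.
Qed.

Lemma ser_value_shift a : disc_summable (fshift a) ->
  ser_value a z = a 0%N + z * ser_value (fshift a) z.
Proof.
move=> ha; rewrite {1}[a]psr_shiftE ser_valueD ?ser_valueM ?ser_valueC ?ser_value_z //.
- exact: disc_summable_z.
- exact: disc_summableC.
- by apply: disc_summableM => //; exact: disc_summable_z.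
Qed.

(** One [M] serves every series below [A], as required when the series varies with an exponent or an
    unrolling depth. *)
Lemma ser_value_bound (A : psr R) : disc_majorant A ->
  exists M, forall a, (forall n, cabs (a n) <= A n) -> cabs (ser_value a z) <= M.
Proof.
move=> hA; have [_ /(_ (cabs z))[|M AM]] := hA; first by rewrite cabs_ge0.
exists M => a aA; have ha := disc_summable_le hA aA.
apply: (ccvg_bound (ser_value_ccvg ha)) => N.
apply: le_trans (cabs_sum _ _ _) _; apply: le_trans (AM N).
apply: ler_sum => k _; rewrite /scale_psr cabsM cabsX.
by apply: ler_wpM2r => //; exact: exprn_ge0.
Qed.

Lemma exprn_cabs_small (x : C) (M e : R) : cabs x < 1 -> 0 < e ->
  exists N, forall n, (N <= n)%N -> cabs x ^+ n * M < e.
Proof.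
move=> x1 e0; have := @cvg_geometric R M (cabs x).
rewrite ger0_norm // => /(_ x1) /cvgrPdist_lt /(_ _ e0)[N _ NP].
exists N => n /NP; rewrite sub0r normrN /geometric /= mulrC.
exact/le_lt_trans/ler_norm.
Qed.

End Value.

(** Powers of [f] control compositions with [f]; powers of [f / z] keep the values of [f] inside the
    disc. *)
Definition power_bounded f := f 0%N = 0 /\
  forall k n, cabs ((f ^+ k) n) <= 1 /\ cabs (((fshift f : psr C) ^+ k) n) <= 1.

Lemma power_bounded_coef f n : power_bounded f -> cabs (f n) <= 1.
Proof. by move=> [_ /(_ 1%N n)[]]. Qed.

Lemma power_bounded_shift_coef f n : power_bounded f -> cabs (fshift f n) <= 1.
Proof. by move=> [_ /(_ 1%N n)[]]. Qed.

Lemma power_bounded_eta (m : nat -> C) : circle_moments m -> power_bounded (eta_psr m).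
Proof.
move=> /circle_contraction cm; split=> [|k n]; first exact: eta_psr0.
split; apply/cabs_le1/contraction_coef/contractionX => //.
exact: contraction_shift.
Qed.

Lemma cabs_comp_psr f g n : power_bounded f -> (forall k, cabs (g k) <= 1) ->
  cabs (comp_psr g f n) <= n.+1%:R.
Proof.
move=> [_ pf] g1; rewrite /comp_psr /fcomp; apply: le_trans (cabs_sum _ _ _) _.
apply: le_trans (_ : \sum_(k < n.+1) 1 <= _); last by rewrite sumr_const card_ord.
apply: ler_sum => k _; rewrite cabsM -psrX mulr_ile1 //.
exact: (pf k n).1.
Qed.

Lemma disc_summable_comp f g : power_bounded f -> (forall k, cabs (g k) <= 1) ->
  disc_summable (comp_psr g f).
Proof.
move=> pf g1; apply: disc_summable_le (disc_majorantS R) _ => n.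
exact: cabs_comp_psr.
Qed.

(** A Schwarz lemma: f(z)^N is z^N times the value of [fshift f ^+ N], bounded uniformly in [N], so
    it becomes smaller than 1 in modulus. *)
Lemma cabs_ser_value_lt1 f z : power_bounded f -> cabs z < 1 -> cabs (ser_value f z) < 1.
Proof.
move=> pf z1; have hs : disc_summable (fshift f).
  by apply: (@disc_summable_bounded _ 1) => n; exact: power_bounded_shift_coef.
have [M MP] := ser_value_bound z1 (disc_majorant_cst (@ler01 R)).
rewrite ltNge; apply/negP => w1.
have [N /(_ N (leqnn N))] := exprn_cabs_small M z1 (@ltr01 R).
apply/negP; rewrite -leNgt; have f0 := pf.1.
have : 1 <= cabs (ser_value f z) ^+ N by rewrite exprn_ege1.
move=> h; apply: le_trans h _.
rewrite (ser_value_shift z1 hs) f0 add0r cabsM exprMn.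
apply: ler_wpM2l; first exact: exprn_ge0.
rewrite -cabsX -ser_valueX //; apply: MP => n; exact: (pf.2 N n).2.
Qed.

(* Unrolling [h (f) = h 0 + f * (fshift h) (f)], the remainder after K steps is
   [w ^ K] times a value bounded uniformly in K. *)
Lemma ser_value_comp f h z : power_bounded f -> (forall k, cabs (h k) <= 1) ->
  cabs z < 1 -> ser_value (comp_psr h f) z = ser_value h (ser_value f z).
Proof.
move=> pf h1 z1; set w := ser_value f z.
have w1 : cabs w < 1 by exact: cabs_ser_value_lt1.
have hf : disc_summable f.
  by apply: (@disc_summable_bounded _ 1) => n; exact: power_bounded_coef.
have hh : disc_summable h by exact: disc_summable_bounded h1.
apply/esym; apply: ccvg_uniq (ser_value_ccvg w1 hh) _.
have step : forall g, (forall k, cabs (g k) <= 1) ->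
    ser_value (comp_psr g f) z = g 0%N + w * ser_value (comp_psr (fshift g) f) z.
  move=> g g1; rewrite comp_psr_shift; last exact: pf.1.
  have hc : disc_summable (comp_psr (fshift g) f).
    by apply: disc_summable_comp => // k; exact: g1.
  rewrite ser_valueD ?ser_valueC ?ser_valueM //; first exact: disc_summableC.
  exact: disc_summableM.
have unroll K : ser_value (comp_psr h f) z = \sum_(k < K) scale_psr w h k +
    w ^+ K * ser_value (comp_psr (fun n => h (K + n)%N) f) z.
  elim: K => [|K ->]; first by rewrite big_ord0 add0r expr0 mul1r.
  rewrite [in LHS]step; last by move=> k; exact: h1.
  rewrite big_ord_recr /= /scale_psr addn0 exprSr.
  have -> : fshift (fun n => h (K + n)%N) = (fun n => h (K.+1 + n)%N).
    by apply/funext => n; rewrite /fshift addnS.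
  by ring.
have [M MP] := ser_value_bound z1 (disc_majorantS R).
move=> e e0; have [N NP] := exprn_cabs_small M w1 e0.
exists N => n /NP; apply: le_lt_trans.
rewrite (unroll n) opprD addrA subrr sub0r cabsN cabsM cabsX.
apply: ler_wpM2l; first exact: exprn_ge0.
by apply: MP => k; apply: cabs_comp_psr => // j; exact: h1.
Qed.

(** 1 + psi = 1 / (1 - eta) is the sum of all powers of eta. Only those up to [n] reach degree [n],
    whence the bound (n + 1) A(n). *)
Lemma disc_summable_psi (m : nat -> C) (A : psr R) : disc_majorant A ->
  (forall k n, cabs ((eta_psr m ^+ k) n) <= A n) -> disc_summable (psi_psr m).
Proof.
move=> hA eA; have e0 := eta_psr0 m.
(* [J] is the geometric series 1 / (1 - z). *)
pose J : psr C := fun=> 1.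
have JE : (1 - psr_z C) * J = 1.
  rewrite mulrBl mul1r; apply/funext => -[|n].
    by rewrite psrD psrN psr_zM0 psr1 subr0.
  by rewrite psrD psrN psr_zMS psr1 subrr.
have zE : comp_psr (psr_z C) (eta_psr m) = eta_psr m.
  rewrite comp_psr_shift // -[psr_z C]mulr1 fshift_zM comp_psr1 // mulr1 mulr1.
  by rewrite (_ : psrC _ = 0) ?add0r //; apply/funext => -[].
have psiE : 1 + psi_psr m = comp_psr J (eta_psr m).
  apply: (@psr_mulIf _ (1 - eta_psr m)).
    by rewrite psrD psrN e0 subr0.
  rewrite eta_psi_inv -{1}zE -(comp_psr1 e0) -comp_psrN -comp_psrD -comp_psrM //.
  by rewrite JE.
have hp : disc_summable (1 + psi_psr m).
  apply: disc_summable_le (disc_majorant_pointwise (disc_majorantS R) hA) _ => n.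
  rewrite psiE /comp_psr /fcomp; apply: le_trans (cabs_sum _ _ _) _.
  apply: le_trans (_ : \sum_(k < n.+1) A n <= _).
    by apply: ler_sum => k _; rewrite mul1r -psrX.
  by rewrite sumr_const card_ord mulr_natl.
have -> : psi_psr m = - 1 + (1 + psi_psr m) by rewrite addKr.
apply: disc_summableD => //; apply: disc_summableN; exact: disc_summableC.
Qed.

(** Evaluating (1 - eta)(1 + psi) = 1 at [z] shows that the denominator 1 + psi(z) is nonzero. *)
Lemma eta_funE (m : nat -> C) (A : psr R) z : disc_majorant A ->
  (forall k n, cabs ((eta_psr m ^+ k) n) <= A n) -> cabs z < 1 ->
  eta_fun m z = ser_value (eta_psr m) z.
Proof.
move=> hA eA z1; have hp := disc_summable_psi hA eA.
have he : disc_summable (eta_psr m).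
  by apply: disc_summable_le hA _ => n; have := eA 1%N n; rewrite expr1.
have h1 : disc_summable 1 by exact: disc_summableC.
have v1 : ser_value (1 : psr C) z = 1 by rewrite -psrC1 ser_valueC.
have := congr1 (fun a => ser_value a z) (eta_psi m).
have := congr1 (fun a => ser_value a z) (eta_psi_inv m).
have h1e : disc_summable (1 - eta_psr m).
  by apply: disc_summableD => //; exact: disc_summableN.
have h1p : disc_summable (1 + psi_psr m) by exact: disc_summableD.
rewrite /= !ser_valueM // !ser_valueD // ?v1; last exact: disc_summableN.
move=> inv /esym pE; rewrite /eta_fun -[psi_fun m z]/(ser_value (psi_psr m) z).
rewrite {1}pE mulfK //; apply/eqP => p0; move: inv; rewrite p0 mulr0 => /esym/eqP.
by rewrite oner_eq0.
Qed.

Lemma eta_fun_circle (m : nat -> C) z : circle_moments m -> cabs z < 1 ->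
  eta_fun m z = ser_value (eta_psr m) z.
Proof.
move=> /power_bounded_eta[_ pm]; apply: eta_funE (disc_majorant_cst (@ler01 R)) _ => k n.
exact: (pm k n).1.
Qed.

Lemma h_funE (m : nat -> C) w : circle_moments m -> cabs w < 1 ->
  h_fun m w = ser_value (fshift (eta_psr m)) w.
Proof.
move=> cm w1; have pm := power_bounded_eta cm.
have hs : disc_summable (fshift (eta_psr m)).
  by apply: (@disc_summable_bounded _ 1) => n; exact: power_bounded_shift_coef.
(* At [w = 0] the prescribed value [m 1] is the constant term of [eta / z]. *)
rewrite /h_fun; case: eqP => [w0|/eqP w0].
  have hs2 : disc_summable (fshift (fshift (eta_psr m))).
    by apply: (@disc_summable_bounded _ 1) => n; exact: (power_bounded_coef n.+2).
  by rewrite ser_value_shift // w0 mul0r addr0 /fshift eta_psr1.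
by rewrite eta_fun_circle // ser_value_shift // eta_psr0 add0r mulrC mulKf.
Qed.

End ComplexSeries.

(** * The convolution formulas, formal and analytic *)

Theorem theorem3p3 (R : realType) (A : algType R[i]) (phi psi : {scalar A})
  (X Y : A) (phi1 : phi 1 = 1) (psi1 : psi 1 = 1)
  (Hind : c_monotone_indep phi psi (X - 1) Y) :
  let mu1 := distr phi X in
  let nu1 := distr psi X in
  let mu2 := distr phi Y in
  let nu2 := distr psi Y in
  (* (mu1 |>_{nu2} mu2, nu1 |> nu2) = (mu_{XY}, nu_{XY}) *)
  let mu := distr phi (X * Y) in
  let nu := distr psi (X * Y) in
  [/\ eta_ser mu = fmul (eta_ser mu2) (fcomp (fshift (eta_ser mu1)) (eta_ser nu2)),
      eta_ser nu = fcomp (eta_ser nu1) (eta_ser nu2),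
      ((forall n, eta_ser nu2 n = 0) ->
         eta_ser mu = (fun n => mu1 1%N * eta_ser mu2 n)) &
      (circle_moments mu1 -> circle_moments nu1 ->
       circle_moments mu2 -> circle_moments nu2 ->
       forall z : R[i], `|z| < 1 ->
         eta_fun mu z = eta_fun mu2 z * h_fun mu1 (eta_fun nu2 z) /\
         eta_fun nu z = eta_fun nu1 (eta_fun nu2 z))].
Proof.
move=> mu1 nu1 mu2 nu2 mu nu.
have muE := eta_c_monotone_conv phi1 Hind; have nuE := eta_monotone_conv psi1 Hind.
split=> [||nu20|c1 d1 c2 d2 z].
- exact: muE.
- exact: nuE.
(* Composing with 0 leaves the constant term of [h], which is the first moment of [mu1]. *)
- have e0 : eta_psr (distr psi Y) = 0 by apply/funext => n; exact: nu20.
  rewrite -[eta_ser mu]/(eta_psr (distr phi (X * Y))) muE e0 comp_psr_shift //.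
  by apply/funext => n; rewrite mul0r addr0 mulrC psrCM /fshift eta_psr1.
rewrite complex_normE ltcR => z1.
have [p1 q1 p2 q2] := And4 (power_bounded_eta c1) (power_bounded_eta d1)
  (power_bounded_eta c2) (power_bounded_eta d2).
(* The outer functions are evaluated at the value of eta of [nu2], which must stay in the disc. *)
have w1 := cabs_ser_value_lt1 q2 z1.
have hb : forall k, cabs (fshift (eta_psr mu1) k) <= 1.
  by move=> k; exact: power_bounded_shift_coef.
rewrite (eta_fun_circle c2 z1) (eta_fun_circle d2 z1).
rewrite (h_funE c1 w1) (eta_fun_circle d1 w1).
have hc : disc_summable (comp_psr (fshift (eta_psr mu1)) (eta_psr nu2)).
  exact: disc_summable_comp.
have h2 : disc_summable (eta_psr mu2).
  by apply: (@disc_summable_bounded _ _ 1) => n; exact: power_bounded_coef.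
(* No measure is at hand for [X * Y], so its eta powers are bounded through the factorization:
   [n.+1] products of a coefficient at most 1 and one at most [n.+1]. *)
have powM k n : cabs ((eta_psr mu ^+ k) n) <= n.+1%:R * n.+1%:R.
  rewrite [eta_psr mu]muE exprMn -(comp_psrX _ _ (eta_psr0 nu2)) psrM.
  apply: le_trans (cabs_sum _ _ _) _.
  apply: le_trans (_ : \sum_(i < n.+1) n.+1%:R <= _); last first.
    by rewrite sumr_const card_ord mulr_natl.
  apply: ler_sum => i _; rewrite cabsM -[leRHS]mul1r.
  apply: ler_pM; [exact: cabs_ge0|exact: cabs_ge0|exact: (p2.2 k i).1|].
  apply: le_trans (cabs_comp_psr _ q2 _) _; last by rewrite ler_nat ltnS leq_subr.
  by move=> j; exact: (p1.2 k j).2.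
have powN k n : cabs ((eta_psr nu ^+ k) n) <= n.+1%:R.
  rewrite [eta_psr nu]nuE -(comp_psrX _ _ (eta_psr0 nu2)).
  by apply: (cabs_comp_psr _ q2) => j; exact: (q1.2 k j).1.
have mS := disc_majorantS R; split.
- rewrite (eta_funE (disc_majorant_pointwise mS mS) powM z1) [eta_psr mu]muE.
  by rewrite (ser_valueM z1 h2 hc) (ser_value_comp q2 hb z1).
- rewrite (eta_funE mS powN z1) [eta_psr nu]nuE.
  exact: (ser_value_comp q2 (fun k => power_bounded_coef k q1) z1).
Qed.
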